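(* Let $\mathcal{C}_{\mathsf L}$ be a class of Kripke models all of which satisfy the frame condition $$\bigwedge_{i=1}^{m} w_i R o_i \to \exists y_1 \ldots \exists y_k \bigwedge_{j=1}^{l} x_j R e_j ,$$ and let $\rho$ be the corresponding geometric labelled rule $$\frac{\mathsf{x}_1R\mathsf{e}_1, \ldots, \mathsf{x}_lR\mathsf{e}_l, \mathsf{w}_1R\mathsf{o}_1, \ldots, \mathsf{w}_mR\mathsf{o}_m, \Gamma \Rightarrow \Delta}{\mathsf{w}_1R\mathsf{o}_1, \ldots, \mathsf{w}_mR\mathsf{o}_m, \Gamma \Rightarrow \Delta}$$ with eigenvariables $\mathsf{y}_1,\ldots,\mathsf{y}_k$, satisfying the subterm property. Suppose that $\rho$ is interpolable for $\mathcal{C}_{\mathsf L}$ with eigenvariables (in this order) $\vec{\mathsf y}=\mathsf{y}_1,\ldots,\mathsf{y}_k$, and let the multiformula $\mho$ in CNF be an interpolant (w.r.t. $\mathcal{C}_{\mathsf L}$) of the premise of an instance of $\rho$. Then $\mathsf{rem}(\vec{\mathsf y},\rho,\mho)$ is an interpolant (w.r.t. $\mathcal{C}_{\mathsf L}$) of the conclusion of this instance.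
   Context: Modal formulas are in negation normal form: built from positive atoms $P$, negative atoms $\overline{P}$, $\top,\bot$ by $\wedge,\vee,\Box,\Diamond$. Kripke models $\mathcal{M}=(W,R,V)$ and $\mathcal{M},w\Vdash A$ are standard. Empty disjunctions are $\bot$. Labelled sequents. Fix a countable set $\mathsf W$ of labels. A labelled sequent $\Gamma\Rightarrow\Delta$ consists of a finite multiset $\Gamma$ of labelled formulas $\mathsf w:A$ and relational atoms $\mathsf wR\mathsf o$, and a finite multiset $\Delta$ of labelled formulas (relational atoms do not occur in consequents). An interpretation into $\mathcal{M}$ is a function $[\![\cdot]\!]:\mathsf W\to W$; it is a good $\mathcal{M}$-map on $\Gamma\Rightarrow\Delta$ if $[\![\mathsf w]\!]R[\![\mathsf o]\!]$ for each $\mathsf wR\mathsf o\in\Gamma$. $[\![\cdot]\!]_{\vec{\mathsf y}}^{\vec y}$ is the interpretation that maps each $\mathsf y_i$ to $y_i$ and agrees with $[\![\cdot]\!]$ elsewhere. $\mathcal{M}\vDash[\![\mathsf{Ant}(\Gamma)]\!]$ means $\mathcal{M},[\![\mathsf w]\!]\Vdash A$ for each $\mathsf w:A\in\Gamma$; $\mathcal{M}\vDash[\![\mathsf{Cons}(\Delta)]\!]$ means $\mathcal{M},[\![\mathsf o]\!]\Vdash B$ for some $\mathsf o:B\in\Delta$. Multiformulas are built from labelled formulas by external disjunction $\curlyvee$ and external conjunction $\curlywedge$; $\mathcal{M}\vDash[\![\mathsf w:C]\!]$ iff $\mathcal{M},[\![\mathsf w]\!]\Vdash C$, and $\curlyvee,\curlywedge$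 are interpreted classically. CNF means an external conjunction of external disjunctions of labelled formulas. A multiformula $\mho$ is an interpolant of $\Gamma\Rightarrow\Delta$ w.r.t. a class $\mathcal{C}_{\mathsf L}$ of Kripke models if (1) each label in $\mho$ occurs in $\Gamma$ or in $\Delta$; (2) each positive atom $P$ in $\mho$ occurs both in $\Gamma$ and in $\Delta$; (3) each negative atom $\overline P$ in $\mho$ occurs both in $\Gamma$ and in $\Delta$; (4) for each $\mathcal{M}\in\mathcal{C}_{\mathsf L}$ and each good $\mathcal{M}$-map $[\![\cdot]\!]$ on $\Gamma\Rightarrow\Delta$: $\mathcal{M}\vDash[\![\mathsf{Ant}(\Gamma)]\!]$ implies $\mathcal{M}\vDash[\![\mho]\!]$, and $\mathcal{M}\vDash[\![\mho]\!]$ implies $\mathcal{M}\vDash[\![\mathsf{Cons}(\Delta)]\!]$. Geometric rule. The displayed labels are fixed; $\mathsf y_1,\dots,\mathsf y_k$ are pairwise distinct eigenvariables, i.e. do not occur among the $\mathsf w_i,\mathsf o_i$ nor in $\Gamma,\Delta$. It is assumed that $\{\mathsf x_j,\mathsf e_j\}\cap\{\mathsf y_1,\dots,\mathsf y_k\}\neq\varnothing$ for each $j$, and $\{\mathsf y_1,\dots,\mathsf y_k\}\subseteq\{\mathsf x_1,\mathsf e_1,\dots,\mathsf x_l,\mathsf e_l\}$. Instances are obtained by letting $\Gamma,\Delta$ vary. Subterm property: each $\mathsf x_j$ and $\mathsf e_j$ that is not an eigenvariable occurs in the conclusion. The frame condition is the one obtained by reading labels as variables over worlds, universally closed over the variables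 other than $y_1,\dots,y_k$. A conmap (into $\mathcal{M}$) for (an instance of) the rule is a good $\mathcal{M}$-map $[\![\cdot]\!]$ on its conclusion; a premap for the conmap $[\![\cdot]\!]$ is an interpretation $[\![\cdot]\!]_{\vec{\mathsf y}}^{\vec y}$ that is a good $\mathcal{M}$-map on the premise. The rule is interpolable for $\mathcal{C}_{\mathsf L}$ with eigenvariables $\mathsf y_1,\dots,\mathsf y_k$ (in this order) if: (connectedness) for each $\mathsf y_j$ the antecedent of the premise contains $\mathsf xR\mathsf y_j$ for some non-eigenvariable $\mathsf x$ or $\mathsf y_{j'}R\mathsf y_j$ for some $j'<j$; one such ''parent'' $\mathsf{par}(\mathsf y_j)$ is chosen and fixed for each $j$; and for any $\mathcal{M}=(W,R,V)\in\mathcal{C}_{\mathsf L}$, any conmap $[\![\cdot]\!]$ into $\mathcal{M}$, any premap $[\![\cdot]\!]_{\mathsf y_1,\dots,\mathsf y_k}^{y_1,\dots,y_k}$ for it, and each $j=1,\dots,k$: (pushability) for any world $y'_j$ with $y_jRy'_j$ there is a premap $[\![\cdot]\!]_{\mathsf y_1,\dots,\mathsf y_{j-1},\mathsf y_j,\dots,\mathsf y_k}^{y_1,\dots,y_{j-1},y'_j,\dots,y'_k}$ for $[\![\cdot]\!]$ (for some $y'_{j+1},\dots,y'_k$); (conjoinability) for any worlds $z_1,\dots,z_s$ with $[\![\mathsf{par}(\mathsf y_j)]\!]_{\mathsf y_1,\dots,\mathsf y_k}^{y_1,\dots,y_k}Rz_t$ for all $t$, there is a premap $[\![\cdot]\!]_{\mathsf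 y_1,\dots,\mathsf y_{j-1},\mathsf y_j,\dots,\mathsf y_k}^{y_1,\dots,y_{j-1},y'_j,\dots,y'_k}$ for $[\![\cdot]\!]$ with $z_tRy'_j$ for all $t=1,\dots,s$. Transformation. For labels $\mathsf y\ne\mathsf x$ and a multiformula in CNF, $$\mathsf{rem}\Bigl(\mathsf y,\mathsf x,\mathop{\curlywedge}\nolimits_{r=1}^{s}\mathop{\curlyvee}\nolimits_{b=1}^{t_r}\mathsf v_{rb}:D_{rb}\Bigr):=\mathop{\curlywedge}\nolimits_{r=1}^{s}\Bigl(\mathsf x:\Diamond\Box\bigvee_{\mathsf v_{rb}=\mathsf y}D_{rb}\ \curlyvee\ \mathop{\curlyvee}\nolimits_{\mathsf v_{rb}\neq\mathsf y}\mathsf v_{rb}:D_{rb}\Bigr)$$ (here $\curlywedge,\curlyvee$ carrying an index range denote iterated $\curlywedge,\curlyvee$). For a rule $\rho$ interpolable with eigenvariables $\vec{\mathsf y}$ and $\mho$ in CNF put $\mathsf{rem}_k(\vec{\mathsf y},\rho,\mho):=\mho$ and $\mathsf{rem}_j(\vec{\mathsf y},\rho,\mho):=\mathsf{rem}\bigl(\mathsf y_{j+1},\mathsf{par}(\mathsf y_{j+1}),\mathsf{rem}_{j+1}(\vec{\mathsf y},\rho,\mho)\bigr)$ for $0\le j\le k-1$; finally $\mathsf{rem}(\vec{\mathsf y},\rho,\mho):=\mathsf{rem}_0(\vec{\mathsf y},\rho,\mho)$. *)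

(* Defs.v *)
From HB Require Import structures.
From mathcomp Require Import all_boot.

Set Implicit Arguments.
Unset Strict Implicit.
Unset Printing Implicit Defensive.

Inductive form (At : Type) : Type :=
| Pos of At
| Neg of At
| Top
| Bot
| And of form At & form At
| Or of form At & form At
| Box of form At
| Dia of form At.

Arguments Top {At}.
Arguments Bot {At}.

Lemma form_comparable (At : eqType) : comparable (form At).
Proof.
rewrite /comparable => A B; rewrite /decidable.
by decide equality; apply: eq_comparable.
Qed.

HB.instance Definition _ (At : eqType) :=
  hasDecEq.Build (form At) (compareP (@form_comparable At)).

Fixpoint pos_atoms (At : Type) (A : form At) : seq At :=
  match A with
  | Pos P => [:: P]
  | Neg _ | Top | Bot => [::]
  | And B D | Or B D => pos_atoms B ++ pos_atoms D
  | Box B | Dia B => pos_atoms B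
  end.

Fixpoint neg_atoms (At : Type) (A : form At) : seq At :=
  match A with
  | Neg P => [:: P]
  | Pos _ | Top | Bot => [::]
  | And B D | Or B D => neg_atoms B ++ neg_atoms D
  | Box B | Dia B => neg_atoms B
  end.

Fixpoint disj (At : Type) (s : seq (form At)) : form At :=
  match s with
  | [::] => Bot
  | [:: A] => A
  | A :: s' => Or A (disj s')
  end.

Record kripke (At : Type) : Type := Kripke {
  world :> Type;
  world_inhabited : inhabited world;
  acc : world -> world -> Prop;
  valuation : At -> world -> Prop
}.

Fixpoint forces (At : Type) (M : kripke At) (w : M) (A : form At) : Prop :=
  match A with
  | Pos P => valuation P w
  | Neg P => ~ valuation P w
  | Top => True
  | Bot => False
  | And B D => forces w B /\ forces w D
  | Or B D => forces w B \/ forces w D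
  | Box B => forall v : M, acc w v -> forces v B
  | Dia B => exists2 v : M, acc w v & forces v B
  end.

(* Multisets are represented by sequences: every notion below depends only on
   membership.  The antecedent is stored as its relational atoms w R o (rels)
   and its labelled formulas w : A (ant). *)
Record sequent (L At : Type) : Type := Sequent {
  rels : seq (L * L);
  ant : seq (L * form At);
  csq : seq (L * form At)
}.

Definition rel_labels (L : Type) (r : seq (L * L)) : seq L :=
  unzip1 r ++ unzip2 r.

Definition sequent_labels (L At : Type) (S : sequent L At) : seq L :=
  rel_labels (rels S) ++ unzip1 (ant S) ++ unzip1 (csq S).

Definition pos_atoms_of (L At : Type) (s : seq (L * form At)) : seq At :=
  flatten [seq pos_atoms a.2 | a <- s].

Definition neg_atoms_of (L At : Type) (s : seq (L * form At)) : seq At :=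
  flatten [seq neg_atoms a.2 | a <- s].

Definition rels_hold (L : eqType) (At : Type) (M : kripke At)
    (r : seq (L * L)) (f : L -> M) : Prop :=
  forall u v : L, (u, v) \in r -> acc (f u) (f v).

Definition good_map (L : eqType) (At : Type) (M : kripke At)
    (S : sequent L At) (f : L -> M) : Prop :=
  rels_hold (rels S) f.

Definition sat_ant (L At : eqType) (M : kripke At)
    (S : sequent L At) (f : L -> M) : Prop :=
  forall (w : L) (A : form At), (w, A) \in ant S -> forces (f w) A.

Definition sat_cons (L At : eqType) (M : kripke At)
    (S : sequent L At) (f : L -> M) : Prop :=
  exists (o : L) (B : form At), (o, B) \in csq S /\ forces (f o) B.

Inductive mform (L At : Type) : Type :=
| MLab of L & form At
| MOr of mform L At & mform L At
| MAnd of mform L At & mform L At.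

Fixpoint msat (L At : Type) (M : kripke At) (f : L -> M)
    (U : mform L At) : Prop :=
  match U with
  | MLab w A => forces (f w) A
  | MOr U1 U2 => msat f U1 \/ msat f U2
  | MAnd U1 U2 => msat f U1 /\ msat f U2
  end.

(* The labelled formulas occurring in a multiformula, from left to right. *)
Fixpoint literals (L At : Type) (U : mform L At) : seq (L * form At) :=
  match U with
  | MLab w A => [:: (w, A)]
  | MOr U1 U2 | MAnd U1 U2 => literals U1 ++ literals U2
  end.

Fixpoint is_clause (L At : Type) (U : mform L At) : bool :=
  match U with
  | MLab _ _ => true
  | MOr U1 U2 => is_clause U1 && is_clause U2
  | MAnd _ _ => false
  end.

(* Any bracketing of the iterated connectives is allowed. There are no empty
   external conjunctions or disjunctions. *)
Fixpoint is_cnf (L At : Type) (U : mform L At) : bool :=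
  match U with
  | MAnd U1 U2 => is_cnf U1 && is_cnf U2
  | C => is_clause C
  end.

Record interpolant (L At : eqType) (C : kripke At -> Prop)
    (S : sequent L At) (U : mform L At) : Prop := Interpolant {
  interpolant_labels : forall w : L,
    w \in unzip1 (literals U) -> w \in sequent_labels S;
  interpolant_pos : forall P : At,
    P \in pos_atoms_of (literals U) ->
    P \in pos_atoms_of (ant S) /\ P \in pos_atoms_of (csq S);
  interpolant_neg : forall P : At,
    P \in neg_atoms_of (literals U) ->
    P \in neg_atoms_of (ant S) /\ P \in neg_atoms_of (csq S);
  interpolant_sat : forall M : kripke At, C M ->
    forall f : L -> M, good_map S f ->
    (sat_ant S f -> msat f U) /\ (msat f U -> sat_cons S f)
}.

(* r_wo lists the atoms w_i R o_i kept in the conclusion, r_xe the atoms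
   x_j R e_j present in the premise only; the order of the eigenvariables
   matters. *)
Record georule (L : eqType) (k : nat) : Type := GeoRule {
  r_wo : seq (L * L);
  r_xe : seq (L * L);
  eigen : k.-tuple L;
  eigen_uniq : uniq eigen;
  eigen_fresh : forall y : L, y \in eigen -> y \notin rel_labels r_wo;
  xe_meets_eigen : forall x e : L, (x, e) \in r_xe ->
    (x \in eigen) || (e \in eigen);
  eigen_in_xe : forall y : L, y \in eigen -> y \in rel_labels r_xe
}.

(* The instances of a rule are indexed by the context S, i.e. Gamma => Delta. *)
Definition premise (L At : eqType) (k : nat) (rho : georule L k)
    (S : sequent L At) : sequent L At :=
  Sequent (r_xe rho ++ r_wo rho ++ rels S) (ant S) (csq S).

Definition conclusion (L At : eqType) (k : nat) (rho : georule L k)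
    (S : sequent L At) : sequent L At :=
  Sequent (r_wo rho ++ rels S) (ant S) (csq S).

Definition is_instance (L At : eqType) (k : nat) (rho : georule L k)
    (S : sequent L At) : Prop :=
  forall y : L, y \in eigen rho -> y \notin sequent_labels S.

(* Stated per instance, since a non-eigenvariable among the x_j, e_j may occur
   in the conclusion through Gamma or Delta only (e.g. seriality). *)
Definition subterm_property (L At : eqType) (k : nat) (rho : georule L k)
    (S : sequent L At) : Prop :=
  forall x : L, x \in rel_labels (r_xe rho) -> x \notin eigen rho ->
    x \in sequent_labels (conclusion rho S).

Definition upd (L : eqType) (k : nat) (T : Type) (f : L -> T)
    (y : k.-tuple L) (v : 'I_k -> T) : L -> T :=
  fun u => if [pick i | tnth y i == u] is Some i then v i else f u.

(* Assigning worlds to all labels by f renders the universal closure. *)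
Definition frame_condition (L : eqType) (At : Type) (k : nat)
    (rho : georule L k) (M : kripke At) : Prop :=
  forall f : L -> M, rels_hold (r_wo rho) f ->
    exists v : 'I_k -> M, rels_hold (r_xe rho) (upd f (eigen rho) v).

Definition conmap (L At : eqType) (k : nat) (rho : georule L k)
    (S : sequent L At) (M : kripke At) (f : L -> M) : Prop :=
  good_map (conclusion rho S) f.

(* The interpretation f[y := v] is a premap for f. *)
Definition premap (L At : eqType) (k : nat) (rho : georule L k)
    (S : sequent L At) (M : kripke At) (f : L -> M) (v : 'I_k -> M) : Prop :=
  good_map (premise rho S) (upd f (eigen rho) v).

(* Eigenvariables do not occur in r_wo, Gamma or Delta, so an atom x R y_j of
   the antecedent of a premise must belong to r_xe. *)
Definition connected (L : eqType) (k : nat) (rho : georule L k)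
    (par : 'I_k -> L) : Prop :=
  forall j : 'I_k, (par j, tnth (eigen rho) j) \in r_xe rho /\
    (par j \notin eigen rho \/
     exists2 j' : 'I_k, j' < j & par j = tnth (eigen rho) j').

Definition agree_before (k : nat) (T : Type) (j : 'I_k)
    (v v' : 'I_k -> T) : Prop :=
  forall i : 'I_k, i < j -> v' i = v i.

Definition pushable (L At : eqType) (k : nat) (rho : georule L k)
    (S : sequent L At) (M : kripke At) (f : L -> M) (v : 'I_k -> M)
    (j : 'I_k) : Prop :=
  forall y' : M, acc (v j) y' ->
    exists v' : 'I_k -> M,
      [/\ premap rho S f v', agree_before j v v' & v' j = y'].

Definition conjoinable (L At : eqType) (k : nat) (rho : georule L k)
    (par : 'I_k -> L) (S : sequent L At) (M : kripke At) (f : L -> M)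
    (v : 'I_k -> M) (j : 'I_k) : Prop :=
  forall (s : nat) (z : 'I_s -> M),
    (forall t : 'I_s, acc (upd f (eigen rho) v (par j)) (z t)) ->
    exists v' : 'I_k -> M,
      [/\ premap rho S f v', agree_before j v v' &
          forall t : 'I_s, acc (z t) (v' j)].

Definition interpolable (L At : eqType) (k : nat) (C : kripke At -> Prop)
    (rho : georule L k) (par : 'I_k -> L) : Prop :=
  connected rho par /\
  forall S : sequent L At, is_instance rho S ->
  forall M : kripke At, C M ->
  forall f : L -> M, conmap rho S f ->
  forall v : 'I_k -> M, premap rho S f v ->
  forall j : 'I_k, pushable rho S f v j /\ conjoinable rho par S f v j.

(* The nonempty external disjunction of U followed by the members of s. *)
Fixpoint mdisj (L At : Type) (U : mform L At) (s : seq (L * form At)) :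
    mform L At :=
  if s is (w, A) :: s' then MOr U (mdisj (MLab w A) s') else U.

Definition rem_clause (L : eqType) (At : Type) (y x : L) (U : mform L At) :
    mform L At :=
  mdisj
    (MLab x (Dia (Box (disj [seq d.2 | d <- literals U & d.1 == y]))))
    [seq d <- literals U | d.1 != y].

(* Meaningful on multiformulas in CNF. *)
Fixpoint mrem (L : eqType) (At : Type) (y x : L) (U : mform L At) :
    mform L At :=
  match U with
  | MAnd U1 U2 => MAnd (mrem y x U1) (mrem y x U2)
  | C => rem_clause y x C
  end.

(* The last eigenvariable is removed first, y_1 last. *)
Definition rem_rule (L : eqType) (At : Type) (k : nat) (rho : georule L k)
    (par : 'I_k -> L) (U : mform L At) : mform L At :=
  foldr (fun j => mrem (tnth (eigen rho) j) (par j)) U (enum 'I_k).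

(* Main.v *)
(** Eigenvariables are eliminated one at a time, the last one first.  For each
    stage [j], the multiformula [rem_j] contains no [y_i] with [i >= j], and
    under every premap of every conmap it is implied by the antecedent and
    implies the consequent.  In a clause of [rem_(j+1)], let [D] be the
    disjunction of the formulas labelled [y_j].  If the rest of the clause
    fails, pushability makes [D] true at every successor of [y_j], hence
    [Dia (Box D)] is true at the parent.  Conversely, conjoinability moves
    [y_j] to a common successor of the worlds that witness the formulas
    [Dia (Box D)] of all clauses, where all these [D] hold.  The frame
    condition provides a premap for each conmap, so that nothing is lost when
    stage [0] is reached. *)

Require Import Defs.
From HB Require Import structures.
From mathcomp Require Import all_boot.
From Stdlib Require Import Classical.

Set Implicit Arguments.
Unset Strict Implicit.
Unset Printing Implicit Defensive.

Lemma forces_disj (At : eqType) (M : kripke At) (w : M) (s : seq (form At)) :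
  forces w (disj s) <-> exists2 A, A \in s & forces w A.
Proof.
elim: s => [|A [|B s] IHs]; first by split=> [|[]].
  split=> [wA|[B]]; first by exists A; rewrite ?mem_head.
  by rewrite inE => /eqP->.
have -> : disj [:: A, B & s] = Or A (disj (B :: s)) by [].
split.
  case=> [wA|/IHs[D sD wD]]; first by exists A; rewrite ?mem_head.
  by exists D; rewrite // inE sD orbT.
case=> D; rewrite inE => /predU1P[->|sD] wD; first by left.
by right; apply/IHs; exists D.
Qed.

(** * Removing one label from a multiformula in CNF *)

Section Rem.
Variables (L At : eqType).
Implicit Types (U : mform L At) (s : seq (L * form At)) (x y w : L).

Lemma literals_mdisj U s : literals (mdisj U s) = literals U ++ s.
Proof.
by elim: s U => [|[w A] s IHs] U /=; rewrite ?cats0 // IHs.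
Qed.

Lemma is_clause_mdisj U s : is_clause U -> is_clause (mdisj U s).
Proof.
by elim: s U => [|[w A] s IHs] U //= clU; rewrite clU IHs.
Qed.

Lemma is_clause_cnf U : is_clause U -> is_cnf U.
Proof. by case: U. Qed.

Lemma mrem_clause y x U : is_clause U -> mrem y x U = rem_clause y x U.
Proof. by case: U. Qed.

Lemma cnf_ind (P : mform L At -> Prop) :
  (forall U, is_clause U -> P U) ->
  (forall U1 U2, P U1 -> P U2 -> P (MAnd U1 U2)) ->
  forall U, is_cnf U -> P U.
Proof.
move=> Pcl Pand; elim=> [w A|U1 _ U2 _|U1 IH1 U2 IH2] /= cU; try exact: Pcl.
by case/andP: cU => /IH1 P1 /IH2; apply: Pand.
Qed.

Lemma is_cnf_mrem y x U : is_cnf U -> is_cnf (mrem y x U).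
Proof.
elim/cnf_ind: U / => [U clU|U1 U2 /= -> -> //].
rewrite mrem_clause //; apply: is_clause_cnf.
exact: is_clause_mdisj.
Qed.

Lemma mrem_labels y x U w : is_cnf U ->
  w \in unzip1 (literals (mrem y x U)) ->
  w = x \/ w != y /\ w \in unzip1 (literals U).
Proof.
elim/cnf_ind: U / => [U clU|U1 U2 IH1 IH2 /=].
  rewrite mrem_clause // literals_mdisj /= inE => /predU1P[->|]; first by left.
  case/mapP=> d; rewrite mem_filter => /andP[dy Ud] ->.
  by right; split=> //; apply: map_f.
rewrite /unzip1 !map_cat !mem_cat => /orP[/IH1|/IH2] [->|[-> ->]];
  by [left | right; rewrite ?orbT].
Qed.

Lemma pos_atoms_disj (s : seq (form At)) :
  pos_atoms (disj s) = flatten [seq pos_atoms A | A <- s].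
Proof.
elim: s => [|A [|B s] IHs] //=; first by rewrite cats0.
by congr (_ ++ _); exact: IHs.
Qed.

Lemma neg_atoms_disj (s : seq (form At)) :
  neg_atoms (disj s) = flatten [seq neg_atoms A | A <- s].
Proof.
elim: s => [|A [|B s] IHs] //=; first by rewrite cats0.
by congr (_ ++ _); exact: IHs.
Qed.

(** The literals labelled [y] and the remaining ones together permute the clause, and the prefix
    [Dia (Box _)] carries no atoms. *)
Lemma mrem_pos_atoms y x U : is_cnf U ->
  pos_atoms_of (literals (mrem y x U)) =i pos_atoms_of (literals U).
Proof.
elim/cnf_ind: U / => [U clU|U1 U2 IH1 IH2] P; last first.
  by rewrite /= /pos_atoms_of !map_cat !flatten_cat !mem_cat IH1 IH2.
rewrite mrem_clause // literals_mdisj /= /pos_atoms_of /= pos_atoms_disj.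
rewrite -map_comp -flatten_cat -map_cat.
by apply/perm_mem/perm_flatten/perm_map; rewrite perm_filterC.
Qed.

Lemma mrem_neg_atoms y x U : is_cnf U ->
  neg_atoms_of (literals (mrem y x U)) =i neg_atoms_of (literals U).
Proof.
elim/cnf_ind: U / => [U clU|U1 U2 IH1 IH2] P; last first.
  by rewrite /= /neg_atoms_of !map_cat !flatten_cat !mem_cat IH1 IH2.
rewrite mrem_clause // literals_mdisj /= /neg_atoms_of /= neg_atoms_disj.
rewrite -map_comp -flatten_cat -map_cat.
by apply/perm_mem/perm_flatten/perm_map; rewrite perm_filterC.
Qed.

Variable M : kripke At.
Implicit Types f g : L -> M.

Lemma msat_clause f U : is_clause U ->
  msat f U <-> exists2 d, d \in literals U & forces (f d.1) d.2.
Proof.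
elim: U => [w A|U1 IH1 U2 IH2|//] /=.
  move=> _; split=> [wA|[d]]; first by exists (w, A); rewrite ?mem_head.
  by rewrite inE => /eqP->.
case/andP=> /IH1 E1 /IH2 E2; split.
  by case=> [/E1|/E2] [d Ud fd]; exists d; rewrite // mem_cat Ud ?orbT.
case=> d; rewrite mem_cat => /orP[] Ud fd; [left | right].
  by apply/E1; exists d.
by apply/E2; exists d.
Qed.

Lemma msat_rem_clause f y x U : msat f (rem_clause y x U) <->
  forces (f x)
    (Dia (Box (disj [seq d.2 | d <- literals U & d.1 == y]))) \/
  exists2 d, d \in literals U & d.1 != y /\ forces (f d.1) d.2.
Proof.
rewrite msat_clause; last exact: is_clause_mdisj.
rewrite literals_mdisj; split.
  case=> d; rewrite inE => /predU1P[-> fd|]; first by left.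
  by rewrite mem_filter => /andP[dy Ud] fd; right; exists d.
case=> [fx|[d Ud [dy fd]]].
  exists (x, Dia (Box (disj [seq d.2 | d <- literals U & d.1 == y]))) => //.
  by rewrite mem_head.
by exists d => //; rewrite inE mem_filter dy Ud orbT.
Qed.

(** Only labels of [U] matter: pushability and conjoinability may also move later eigenvariables,
    which [U] no longer contains when this is applied. *)
Definition agree_off y U f g : Prop :=
  forall w, w \in unzip1 (literals U) -> w != y -> g w = f w.

Lemma agree_off_and y U1 U2 f g : agree_off y (MAnd U1 U2) f g ->
  agree_off y U1 f g /\ agree_off y U2 f g.
Proof.
by move=> fg; split=> w Uw; apply: fg;
  rewrite /= /unzip1 map_cat mem_cat Uw ?orbT.
Qed.

(** The hypothesis on [y'] abstracts pushability; the world [f y] itself witnesses the diamond at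
    [x]. *)
Lemma msat_mrem f y x U : is_cnf U -> acc (f x) (f y) ->
  (forall y' : M, acc (f y) y' ->
     exists g, [/\ msat g U, g y = y' & agree_off y U f g]) ->
  msat f (mrem y x U).
Proof.
move=> cU fxy; elim/cnf_ind: U / cU => [U clU|U1 U2 IH1 IH2] push.
  rewrite mrem_clause //; apply/msat_rem_clause.
  case: (classic (exists2 d, d \in literals U & d.1 != y /\ forces (f d.1) d.2)).
    by right.
  move=> restF; left; exists (f y) => // y' /push[g [gU gy fg]].
  apply/forces_disj; case/(msat_clause _ clU): gU => d Ud gd.
  have [dy|dy] := eqVneq d.1 y.
    exists d.2; last by rewrite -gy -dy.
    by apply: map_f; rewrite mem_filter dy eqxx.
  (* A literal true under [g] with label other than [y] is already true under [f], against the
     failure of the rest. *)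
  by case: restF; exists d; rewrite // -fg //; apply: map_f.
split; [apply: IH1 | apply: IH2] => y' /push[g [[g1 g2] gy]];
  by case/agree_off_and=> fg1 fg2; exists g.
Qed.

(** The worlds [z] are diamond witnesses, at most one per clause; conjoinability later supplies a
    common successor of them as the new value of [y]. *)
Lemma mrem_msat f y x U : is_cnf U -> msat f (mrem y x U) ->
  exists (n : nat) (z : 'I_n -> M),
    (forall t, acc (f x) (z t)) /\
    forall g, agree_off y U f g -> (forall t, acc (z t) (g y)) -> msat g U.
Proof.
elim/cnf_ind: U / => [U clU|U1 U2 IH1 IH2].
  rewrite mrem_clause // => /msat_rem_clause[[z xz zD]|[d Ud [dy fd]]].
    exists 1, (fun=> z); split=> // g _ /(_ ord0) /zD /forces_disj[A].
    case/mapP=> d; rewrite mem_filter => /andP[/eqP dy Ud] -> gd.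
    by apply/msat_clause => //; exists d; rewrite ?dy.
  (* A true literal not labelled [y] survives any move of [y], so no witness is required; [f y] is a
     dummy value on the empty index type. *)
  exists 0, (fun=> f y); split=> [[]//|g fg _].
  by apply/msat_clause => //; exists d; rewrite // fg //; apply: map_f.
case=> /IH1[n1 [z1 [xz1 sat1]]] /IH2[n2 [z2 [xz2 sat2]]].
exists (n1 + n2), (fun t => match split t with inl a => z1 a | inr b => z2 b end).
split=> [t|g /agree_off_and[fg1 fg2] zg]; first by case: (split t).
split; [apply: sat1 | apply: sat2] => // t.
  by have := zg (unsplit (inl t)); rewrite unsplitK.
by have := zg (unsplit (inr t)); rewrite unsplitK.
Qed.

End Rem.

(** * Interpretations updated at the eigenvariables *)

Section Update.
Variables (L : eqType) (k : nat) (T : Type) (f : L -> T) (y : k.-tuple L).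
Implicit Types v : 'I_k -> T.

Lemma upd_tnth v i : uniq y -> upd f y v (tnth y i) = v i.
Proof.
move=> /tuple_uniqP inj_y; rewrite /upd; case: pickP => [j /eqP/inj_y-> //|].
by move/(_ i); rewrite eqxx.
Qed.

Lemma upd_notin v u : u \notin y -> upd f y v u = f u.
Proof.
move=> yu; rewrite /upd; case: pickP => // i /eqP Eu.
by rewrite -Eu mem_tnth in yu.
Qed.

Lemma upd_agree_before (j : 'I_k) v v' u : agree_before j v v' ->
  (forall i : 'I_k, j <= i -> u != tnth y i) -> upd f y v' u = upd f y v u.
Proof.
move=> vv' ju; rewrite /upd; case: pickP => // i /eqP Eu; apply: vv'.
by rewrite ltnNge; apply/negP => /ju; rewrite Eu eqxx.
Qed.

End Update.

Lemma mem_rel_labels (L : eqType) (r : seq (L * L)) (u v : L) :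
  (u, v) \in r -> u \in rel_labels r /\ v \in rel_labels r.
Proof.
move=> ruv; rewrite !mem_cat.
by rewrite (map_f (fun p => p.1) ruv) (map_f (fun p => p.2) ruv) orbT.
Qed.

(** * Elimination of the eigenvariables, stage by stage *)

Section Stages.
Variables (L At : eqType) (k : nat) (C : kripke At -> Prop).
Variables (rho : georule L k) (par : 'I_k -> L) (S : sequent L At).
Hypotheses (hrho : interpolable C rho par) (hS : is_instance rho S).

Local Notation y := (tnth (eigen rho)).

Lemma sequent_label_upd (M : kripke At) (f : L -> M) v w :
  w \in sequent_labels S -> upd f (eigen rho) v w = f w.
Proof. by move=> Sw; apply: upd_notin; apply/negP => /hS; rewrite Sw. Qed.

Lemma sat_ant_upd (M : kripke At) (f : L -> M) v :
  sat_ant S (upd f (eigen rho) v) <-> sat_ant S f.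
Proof.
split=> fS w A SA; have := fS w A SA; rewrite sequent_label_upd //;
by rewrite !mem_cat (map_f (fun d => d.1) SA) orbT.
Qed.

Lemma sat_cons_upd (M : kripke At) (f : L -> M) v :
  sat_cons S (upd f (eigen rho) v) <-> sat_cons S f.
Proof.
split=> -[w [A [SA fA]]]; exists w, A; move: fA; rewrite sequent_label_upd //;
by rewrite !mem_cat (map_f (fun d => d.1) SA) !orbT.
Qed.

(** A parent is a non-eigenvariable or a strictly earlier eigenvariable, so removing [y j] never
    reintroduces a label already removed. *)
Lemma par_neq (j i : 'I_k) : j <= i -> par j != y i.
Proof.
move=> ji; apply/eqP => Ej; have [_ []] := hrho.1 j.
  by rewrite Ej mem_tnth.
case=> j' j'j; rewrite Ej.
by move/(tuple_uniqP _ (eigen_uniq rho)) => Ei; rewrite Ei leqNgt j'j in ji.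
Qed.

(* Satisfaction is required under every premap, not just one: pushability and
   conjoinability return a premap whose later components are not controlled. *)
Record stage (j : nat) (U : mform L At) : Prop := Stage {
  stage_cnf : is_cnf U;
  stage_labels : forall w, w \in unzip1 (literals U) ->
    w \in sequent_labels (premise rho S) /\
    (forall i : 'I_k, j <= i -> w != y i);
  stage_pos : forall P, P \in pos_atoms_of (literals U) ->
    P \in pos_atoms_of (ant S) /\ P \in pos_atoms_of (csq S);
  stage_neg : forall P, P \in neg_atoms_of (literals U) ->
    P \in neg_atoms_of (ant S) /\ P \in neg_atoms_of (csq S);
  stage_sat : forall M : kripke At, C M -> forall f : L -> M,
    conmap rho S f -> forall v, premap rho S f v ->
    (sat_ant S f -> msat (upd f (eigen rho) v) U) /\
    (msat (upd f (eigen rho) v) U -> sat_cons S f)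
}.

Lemma stage_init U : is_cnf U -> interpolant C (premise rho S) U -> stage k U.
Proof.
move=> cU [Ul Up Un Us]; split=> // [w Uw|M CM f _ v fv].
  by split=> [|i]; [apply: Ul | rewrite leqNgt ltn_ord].
have [s1 s2] := Us M CM _ fv; split=> [/(sat_ant_upd f v)|]; first exact: s1.
by move/s2; apply: (sat_cons_upd f v).1.
Qed.

Lemma stage_step (j : 'I_k) U : stage j.+1 U -> stage j (mrem (y j) (par j) U).
Proof.
case=> cU Ul Up Un Us.
have par_y : (par j, y j) \in rels (premise rho S).
  by rewrite mem_cat (hrho.1 j).1.
have agree (M : kripke At) (f : L -> M) v v' : agree_before j v v' ->
    agree_off (y j) U (upd f (eigen rho) v) (upd f (eigen rho) v').
  (* The label [w] differs from [y j] by [wj] and from every later eigenvariable by the stage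
     hypothesis, so only the unchanged components are read. *)
  move=> vv' w /Ul[_ w_ne] wj; apply: (upd_agree_before _ vv') => i.
  rewrite leq_eqVlt => /predU1P[/val_inj <- //|]; exact: w_ne.
split=> [|w|P|P|M CM f fcon v fv].
- exact: is_cnf_mrem.
- case/(mrem_labels cU) => [->|[wj /Ul[Sw w_ne]]]; split=> //.
  + by rewrite mem_cat (mem_rel_labels par_y).1.
  + by move=> i; apply: par_neq.
  + by move=> i; rewrite leq_eqVlt => /predU1P[/val_inj <- //|]; apply: w_ne.
- by rewrite mrem_pos_atoms //; apply: Up.
- by rewrite mrem_neg_atoms //; apply: Un.
have [push conj] := hrho.2 S hS M CM f fcon v fv j; split=> [fS|].
  apply: msat_mrem => // [|y']; first exact: fv.
  rewrite upd_tnth ?eigen_uniq // => /push[v' [fv' vv' <-]].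
  exists (upd f (eigen rho) v'); split; last exact: agree.
    by apply: (Us M CM f fcon v' fv').1.
  by rewrite upd_tnth ?eigen_uniq.
case/(mrem_msat cU) => n [z [xz sat]]; have [v' [fv' vv' zv']] := conj n z xz.
(* The stage hypothesis is used at the new premap [v']; its conclusion concerns [f] alone. *)
apply: (Us M CM f fcon v' fv').2; apply: sat; first exact: agree.
by move=> t; rewrite upd_tnth ?eigen_uniq.
Qed.

Lemma stage_rem_rule U : stage k U -> stage 0 (rem_rule rho par U).
Proof.
(* Induction on the number [i] of eigenvariables already removed, which are the last [i] in the
   enumeration. *)
move=> stU; suff st i : i <= k ->
    stage (k - i) (foldr (fun j => mrem (y j) (par j)) U (drop (k - i) (enum 'I_k))).
  by have := st k (leqnn k); rewrite subnn drop0.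
elim: i => [|i IHi] ik.
  by rewrite subn0 drop_oversize // size_enum_ord.
have lt_k : k - i.+1 < k by rewrite ltn_subrL (leq_ltn_trans _ ik).
pose j := Ordinal lt_k; have Ej : (k - i.+1).+1 = k - i by rewrite subnSK.
rewrite (drop_nth j) ?size_enum_ord // Ej.
have -> : nth j (enum 'I_k) (k - i.+1) = j by apply/val_inj; rewrite /= nth_enum_ord.
by apply: (@stage_step j); rewrite /= Ej; apply/IHi/ltnW.
Qed.

(** The frame condition validates the atoms of [r_xe]; the other atoms of the premise contain no
    eigenvariable and keep their meaning under the update. *)
Lemma conmap_premap (M : kripke At) (f : L -> M) : frame_condition rho M ->
  conmap rho S f -> exists v, premap rho S f v.
Proof.
move=> frM fcon.
have [|v fv] := frM f.
  by move=> u w uw; apply: fcon; rewrite mem_cat uw.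
exists v => u w; rewrite mem_cat => /orP[/fv //|uw].
have fresh t : t \in rel_labels (r_wo rho) \/ t \in rel_labels (rels S) ->
    t \notin eigen rho.
  case=> tr; apply/negP => yt; first by rewrite (negPf (eigen_fresh yt)) in tr.
  by have := hS yt; rewrite mem_cat tr.
have [uF wF] : u \notin eigen rho /\ w \notin eigen rho.
  by move: uw; rewrite mem_cat => /orP[] /mem_rel_labels[uL wL];
    split; apply: fresh; auto.
by rewrite !upd_notin //; apply: fcon.
Qed.

End Stages.

(** * From stage 0 to the conclusion of the rule *)

Lemma eq_in_msat (L At : eqType) (M : kripke At) (f g : L -> M)
    (U : mform L At) :
  {in unzip1 (literals U), f =1 g} -> msat f U <-> msat g U.
Proof.
elim: U => [w A|U1 IH1 U2 IH2|U1 IH1 U2 IH2] /= fg.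
  by rewrite fg // mem_head.
all: have E1 : msat f U1 <-> msat g U1
  by apply: IH1 => w Uw; apply: fg; rewrite /unzip1 map_cat mem_cat Uw.
all: have E2 : msat f U2 <-> msat g U2
  by apply: IH2 => w Uw; apply: fg; rewrite /unzip1 map_cat mem_cat Uw orbT.
all: by tauto.
Qed.

Theorem theorem41 (L : countType) (At : eqType) (k : nat)
  (C : kripke At -> Prop) (rho : georule L k) (par : 'I_k -> L)
  (hframe : forall M : kripke At, C M -> frame_condition rho M)
  (hrho : interpolable C rho par)
  (S : sequent L At)
  (hS : is_instance rho S)
  (hsub : subterm_property rho S)
  (U : mform L At)
  (hcnf : is_cnf U)
  (hU : interpolant C (premise rho S) U) :
  interpolant C (conclusion rho S) (rem_rule rho par U).
Proof.
have [_ Rl Rp Rn Rs] := stage_rem_rule hrho hS (stage_init hS hcnf hU).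
have not_eigen w :
    w \in unzip1 (literals (rem_rule rho par U)) -> w \notin eigen rho.
  by move=> /Rl[_ w_ne]; apply/tnthP => -[i /eqP Ew]; have /negP := w_ne i isT.
split=> // [w Rw|M CM f fcon].
  have [Sw _] := Rl w Rw; have wF := not_eigen w Rw.
  (* A label of the premise outside [r_xe] occurs in the conclusion; one inside it does so by the
     subterm property. *)
  have [/hsub/(_ wF) //|xeF] := boolP (w \in rel_labels (r_xe rho)).
  move: Sw xeF; rewrite /sequent_labels /rel_labels /unzip1 /unzip2 /=.
  rewrite !map_cat !mem_cat; do !case: (w \in _) => //.
(* Any premap will do: without eigenvariables, the multiformula has the same truth value under [f]
   and its update. *)
have [v fv] := conmap_premap hS (hframe M CM) fcon.
have Ev : {in unzip1 (literals (rem_rule rho par U)),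
    upd f (eigen rho) v =1 f}.
  by move=> w /not_eigen wF; apply: upd_notin.
have [s1 s2] := Rs M CM f fcon v fv; split=> [fS|fR].
  by apply/(eq_in_msat Ev)/s1.
by apply/s2/(eq_in_msat Ev).
Qed.
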